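(* Let $n>0$ be an integer and let $I$ denote the $2^n\times2^n$ identity matrix. Then for all $\varepsilon\in(0,1/2)$, $$\mathsf{rk}^{\mathrm{psd}}_{\varepsilon}(I)\le\frac{4\sqrt{n}}{\varepsilon}.$$
   Context: For a matrix $M$ with nonnegative real entries, a rank-$d$ psd-factorization of $M$ consists of $d\times d$ complex positive semidefinite matrices $A_i$ (one for each row of $M$) and $B_j$ (one for each column of $M$) such that $M_{ij}=\mathrm{tr}(A_iB_j)$ for all $i,j$. The psd-rank of $M$ is the minimal $d$ for which such a factorization exists. The $\varepsilon$-approximate psd-rank $\mathsf{rk}^{\mathrm{psd}}_{\varepsilon}(M)$ is the minimum psd-rank among all entrywise nonnegative matrices $M'$ with $|M'_{ij}-M_{ij}|\le\varepsilon$ for all $i,j$. *)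

(* Defs.v *)
From mathcomp Require Import all_boot all_order all_algebra.
From mathcomp Require Import complex.
From mathcomp Require Import boolp classical_sets reals.

Set Implicit Arguments.
Unset Strict Implicit.
Unset Printing Implicit Defensive.

Import Order.TTheory GRing.Theory Num.Theory.
Local Open Scope ring_scope.
Local Open Scope complex_scope.
Local Open Scope sesquilinear_scope.
Local Open Scope classical_set_scope.

(* The value on the empty set is 0; by [psd_factorizable_nonempty] and
   [psd_ranks_near_nonempty], the sets minimized below are nonempty on the
   matrices of interest. *)
Definition nat_min (P : set nat) : nat :=
  xget 0%N [set d | P d /\ forall k, P k -> (d <= k)%N].

Lemma nat_minP (P : set nat) : P !=set0 ->
  P (nat_min P) /\ forall k, P k -> (nat_min P <= k)%N.
Proof.
move=> [d0 Pd0]; rewrite /nat_min; case: xgetP => [d _ //|] noP.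
have exP : exists d, `[< P d >] by exists d0; apply/asboolP.
case: (ex_minnP exP) => d /asboolP Pd dmin; exfalso; apply: (noP d).
by split=> // k Pk; apply/dmin/asboolP.
Qed.

(* In the order of R[i], 0 <= z says that z is real and nonnegative. *)
Definition psdmx (R : realType) (d : nat) (A : 'M[R[i]]_d) : Prop :=
  A \is hermsymmx /\ forall v : 'cV[R[i]]_d, 0 <= (v^t* *m A *m v) 0 0.

Definition nonnegmx (R : realType) (m n : nat) (M : 'M[R]_(m, n)) : Prop :=
  forall i j, 0 <= M i j.

Definition psd_factorization (R : realType) (m n d : nat) (M : 'M[R]_(m, n))
    (A : 'I_m -> 'M[R[i]]_d) (B : 'I_n -> 'M[R[i]]_d) : Prop :=
  [/\ forall i, psdmx (A i), forall j, psdmx (B j) &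
      forall i j, (M i j)%:C = \tr (A i *m B j)].

Definition psd_factorizable (R : realType) (m n : nat) (M : 'M[R]_(m, n)) :
    set nat :=
  [set d | exists A B, @psd_factorization R m n d M A B].

Definition psd_rank (R : realType) (m n : nat) (M : 'M[R]_(m, n)) : nat :=
  nat_min (psd_factorizable M).

Definition psd_ranks_near (R : realType) (eps : R) (m n : nat)
    (M : 'M[R]_(m, n)) : set nat :=
  [set psd_rank M' | M' in [set M' : 'M[R]_(m, n) |
     nonnegmx M' /\ forall i j, `|M' i j - M i j| <= eps]].

Definition approx_psd_rank (R : realType) (eps : R) (m n : nat)
    (M : 'M[R]_(m, n)) : nat :=
  nat_min (psd_ranks_near eps M).

Lemma psdmx_diag (R : realType) (d : nat) (u : 'rV[R]_d) :
  (forall k, 0 <= u 0 k) -> psdmx (diag_mx (map_mx (real_complex R) u)).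
Proof.
move=> u0; have u0C k : 0 <= (u 0 k)%:C by rewrite ler0c.
split=> [|v].
  apply/is_hermitianmxP; rewrite expr0 scale1r; apply/matrixP => i j.
  rewrite !mxE eq_sym; case: eqP => [->|_]; last by rewrite !mulr0n conjC0.
  by rewrite !mulr1n; symmetry; apply/CrealP/ger0_real.
rewrite mxE; apply: sumr_ge0 => k _; rewrite mul_mx_diag !mxE.
by rewrite mulrAC; apply: mulr_ge0 => //; rewrite mulrC mul_conjC_ge0.
Qed.

Lemma psd_factorizable_nonempty (R : realType) (m n : nat) (M : 'M[R]_(m, n)) :
  nonnegmx M -> psd_factorizable M !=set0.
Proof.
move=> M0; exists n, (fun i => diag_mx (map_mx (real_complex R) (row i M))).
exists (fun j => diag_mx (map_mx (real_complex R) (delta_mx 0 j))).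
split=> [i|j|i j].
- by apply: psdmx_diag => k; rewrite mxE.
- by apply: psdmx_diag => k; rewrite mxE ler0n.
rewrite mulmx_diag mxtrace_diag (bigD1 j) //= big1 => [|k kj].
  by rewrite !mxE !eqxx mulr1 addr0.
by rewrite !mxE (negPf kj) andbF mulr0.
Qed.

Lemma psd_ranks_near_nonempty (R : realType) (eps : R) (m n : nat)
    (M : 'M[R]_(m, n)) :
  0 <= eps -> nonnegmx M -> psd_ranks_near eps M !=set0.
Proof.
move=> e0 M0; exists (psd_rank M), M => //; split=> // i j.
by rewrite subrr normr0.
Qed.

(* Main.v *)
(* Random subspaces. Let G_1, ..., G_N (N = 2^n) be d x r matrices whose entries
   are independent uniform fourth roots of unity, and let P_i be the orthogonal
   projector of rank r onto a space containing the column space of G_i. With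
   A_i = P_i and B_j = G_j G_j^* / (r d), the entry tr(A_i B_j) is 1 for i = j,
   since P_i G_i = G_i. For i <> j, r d tr(A_i B_j) is the sum over the columns g
   of G_j of |P_i g|^2, and E exp(lam |P g|^2) <= (1 - lam)^(-r) for a fixed
   projector P of rank r, the bound given by complex Gaussian vectors. By Markov's
   inequality at lam = 3/4 the entry exceeds eps with probability at most
   4^(r^2) exp(-3/4 eps r d) <= 2^(-n-2), as soon as eps r d >= 2 r^2 + n + 2;
   r = floor (sqrt n) and d = floor (4 sqrt n / eps) satisfy this for n >= 4.
   The relation "tr(A_i B_j) > eps" is not symmetric, but every vertex of this
   sparse digraph has small out-degree, so a greedy choice of vertices of small
   total degree yields N matrices that are pairwise good in both directions.
   For n < 4 the trivial bound 2^n <= 8 sqrt n suffices. *)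
Require Import Defs.
From mathcomp Require Import all_boot all_order all_algebra.
From mathcomp Require Import complex ring lra zify.
From mathcomp Require Import classical_sets reals.
From mathcomp Require Import topology normedtype sequences exp.

Set Implicit Arguments.
Unset Strict Implicit.
Unset Printing Implicit Defensive.

Import Order.TTheory GRing.Theory Num.Theory.
Import numFieldNormedType.Exports.
Local Open Scope ring_scope.
Local Open Scope complex_scope.
Local Open Scope sesquilinear_scope.

Local Notation Re := (@complex.Re _).
Local Notation Im := (@complex.Im _).

(** * Gaussian bound on the hyperbolic cosine *)

Section CoshBound.
Local Open Scope classical_set_scope.

(** Used to compare Taylor coefficients: x^(2m) / (2m)! is at most (x^2 / 2)^m / m!. *)
Lemma fact_double_ge m : (2 ^ m * m`! <= (m.*2)`!)%N.
Proof.
elim: m => // m IH; rewrite doubleS 2!(factS, expnS) factS.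
rewrite (_ : (_ * _ = m.+1.*2 * (2 ^ m * m`!))%N); last by rewrite -muln2; ring.
by rewrite doubleS leq_mul2l (leq_trans IH) ?orbT // leq_pmull.
Qed.

Lemma expR_add_expRN_le (R : realType) (x : R) :
  expR x + expR (- x) <= 2 * expR (x ^+ 2 / 2).
Proof.
(* After 2m terms the odd powers of x and -x have cancelled in pairs, and each remaining even power
   is bounded by its counterpart; the lemma follows in the limit. *)
have even_part m : series (exp_coeff x) m.*2 + series (exp_coeff (- x)) m.*2
    <= 2 * series (exp_coeff (x ^+ 2 / 2)) m.
  rewrite /series /=; elim: m => [|m IH]; first by rewrite !big_geq // mulr0 addr0.
  rewrite doubleS !big_nat_recr //= mulrDr.
  set a := \sum_(_ <= _ < _) _ in IH *; set b := \sum_(_ <= _ < _) _ in IH *.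
  have -> : exp_coeff (- x) m.*2 = exp_coeff x m.*2.
    by rewrite /exp_coeff /= exprNn -signr_odd odd_double mul1r.
  have -> : exp_coeff (- x) m.*2.+1 = - exp_coeff x m.*2.+1.
    by rewrite /exp_coeff /= exprNn -signr_odd /= odd_double mulN1r mulNr.
  suff: exp_coeff x m.*2 <= exp_coeff (x ^+ 2 / 2) m by move: IH; lra.
  rewrite /exp_coeff /= expr_div_n -exprM mul2n -mulrA -invfM.
  rewrite ler_wpM2l ?exprn_even_ge0 ?odd_double //.
  rewrite lef_pV2 ?posrE ?mulr_gt0 ?exprn_gt0 ?ltr0n ?fact_gt0 //.
  by rewrite -natrX -natrM ler_nat fact_double_ge.
have cvx y : series (@exp_coeff R y) @ \oo --> expR y.
  exact: is_cvg_series_exp_coeff.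
have dbl : (fun m => m.*2) @ \oo --> \oo.
  move=> A [N _ NA]; exists N => // m /= Nm; apply: NA => /=.
  by rewrite -addnn (leq_trans Nm) // leq_addr.
have cvx2 y : (fun m => series (@exp_coeff R y) m.*2) @ \oo --> expR y.
  exact: (@cvg_comp _ _ _ double (series (exp_coeff y)) _ _ _ dbl (cvx y)).
have lhs_cvg : (fun m => series (exp_coeff x) m.*2 + series (exp_coeff (- x)) m.*2)
    @ \oo --> expR x + expR (- x) by apply: cvgD; apply: cvx2.
have rhs_cvg : (fun m => 2 * series (exp_coeff (x ^+ 2 / 2)) m)
    @ \oo --> 2 * expR (x ^+ 2 / 2) by apply: cvgM; [exact: cvg_cst | exact: cvx].
by apply: (ler_cvg_to lhs_cvg rhs_cvg); near=> m; apply: even_part.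
Unshelve. all: by end_near. Qed.

End CoshBound.

(** * Exponential moments of Hermitian forms in random phases *)

Section PhaseMgf.
Variable R : realType.
Implicit Types (w z : R[i]).

(** Four phases already satisfy the Gaussian bound [phase_sum], and they keep the sample space
    finite, so that probabilities are cardinalities. *)
Definition phase (k : 'I_4) : R[i] := 'i ^+ k.

Lemma phase_norm k : (phase k)^*%C * phase k = 1.
Proof.
rewrite /phase rmorphXn -exprMn /= (_ : _ * _ = 1) ?expr1n //.
by simpc.
Qed.

(** With w = a + ib the exponents are -2a, -2b, 2a, 2b, so the sum factors as 2 cosh(a + b) times 2
    cosh(a - b), and the two Gaussian bounds multiply because ((a + b)^2 + (a - b)^2) / 2 = a^2 +
    b^2. *)
Lemma phase_sum w :
  \sum_k expR (- (Re ((phase k)^*%C * w) *+ 2))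
    <= 4 * expR (Re w ^+ 2 + Im w ^+ 2).
Proof.
rewrite !big_ord_recl big_ord0 /phase /=.
case: w => a b /=.
rewrite !(mul0r, mul1r, mulr0, mulr1, mulN1r, oppr0, subr0, addr0, add0r, sub0r,
  opprK, mulNr, mulrN).
have -> : expR (- (a *+ 2)) + (expR (- (b *+ 2)) +
    (expR (- (- a *+ 2)) + expR (- (- b *+ 2))))
  = (expR (a + b) + expR (- (a + b))) * (expR (a - b) + expR (- (a - b))).
  rewrite mulrDl !mulrDr -!expRD.
  have [-> -> -> ->] : [/\ a + b + (a - b) = - (- a *+ 2), a + b - (a - b) = - (- b *+ 2),
     - (a + b) + (a - b) = - (b *+ 2) & - (a + b) - (a - b) = - (a *+ 2)] by split; ring.
  ring.
have -> : 4 * expR (a ^+ 2 + b ^+ 2) =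
   (2 * expR ((a + b) ^+ 2 / 2)) * (2 * expR ((a - b) ^+ 2 / 2)).
  rewrite mulrACA -expRD (_ : _ / 2 + _ = a ^+ 2 + b ^+ 2); last by field.
  by congr (_ * _); ring.
by apply: ler_pM; rewrite ?addr_ge0 ?expR_ge0 ?expR_add_expRN_le.
Qed.

(** For Hermitian [M] the form is real-valued, so taking the real part loses nothing. *)
Definition qform d (M : 'M[R[i]]_d) (v : 'cV[R[i]]_d) : R :=
  Re ((v^t* *m M *m v) 0 0).

Definition posdefmx d (M : 'M[R[i]]_d) : Prop :=
  M^t* = M /\ forall v, v != 0 -> 0 < qform M v.

Definition schur_compl d (M : 'M[R[i]]_(1 + d)) : 'M[R[i]]_d :=
  drsubmx M - (M 0 0)^-1 *: (dlsubmx M *m ursubmx M).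

Lemma det_schur_compl d (M : 'M[R[i]]_(1 + d)) :
  M 0 0 != 0 -> \det M = M 0 0 * \det (schur_compl M).
Proof.
move=> a0; set a := M 0 0 in a0 *.
have ulE : ulsubmx M = a%:M.
  by rewrite [LHS]mx11_scalar; congr (_%:M); rewrite !mxE; congr (M _ _); apply/val_inj.
have {1}-> : M = block_mx 1%:M 0 (a^-1 *: dlsubmx M) 1%:M
              *m block_mx a%:M (ursubmx M) 0 (schur_compl M).
  rewrite mulmx_block !mul1mx !mul0mx !addr0 -{1}[M]submxK ulE.
  congr block_mx; first by rewrite -scalemxAl mul_mx_scalar scalerA mulVf // scale1r.
  by rewrite /schur_compl -scalemxAl addrC subrK.
by rewrite det_mulmx det_lblock det_ublock !det1 !mul1r det_scalar1.
Qed.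

(** The lower right block is the Schur complement plus a rank-one term, which contributes the
    summand in |w|^2. When |z| = 1 only the cross term depends on z, and [phase_sum] averages it. *)
Lemma qform_col_mx d (M : 'M[R[i]]_(1 + d)) z (h : 'cV[R[i]]_d) :
  M^t* = M -> M 0 0 != 0 ->
  let w := (ursubmx M *m h) 0 0 in
  qform M (col_mx z%:M h) = Re (M 0 0 * (z^*%C * z)) + Re (z^*%C * w) *+ 2
    + qform (schur_compl M) h + Re ((M 0 0)^-1 * (w^*%C * w)).
Proof.
move=> Mh a0 w; set a := M 0 0 in a0 *.
have ulE : ulsubmx M = a%:M.
  by rewrite [LHS]mx11_scalar; congr (_%:M); rewrite !mxE; congr (M _ _); apply/val_inj.
have dlE : dlsubmx M = (ursubmx M)^t*.
  by rewrite -{1}Mh; apply/matrixP=> i j; rewrite !mxE.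
have hdl : h^t* *m dlsubmx M = (w^*%C)%:M.
  rewrite dlE -map_mxM -trmx_mul (mx11_scalar (_ *m _)) -/w.
  by rewrite tr_scalar_mx map_scalar_mx.
rewrite /qform tr_col_mx map_row_mx -{1}[M]submxK mul_row_block mul_row_col.
have urh : ursubmx M *m h = w%:M by exact: mx11_scalar.
have zE : (z%:M : 'M_1)^t* = (z^*%C)%:M by rewrite tr_scalar_mx map_scalar_mx.
rewrite ulE hdl zE !mulmxDl -[_ *m ursubmx M *m h]mulmxA urh -!scalar_mxM.
rewrite /schur_compl mulmxBr mulmxBl -scalemxAr -scalemxAl mulmxA hdl.
rewrite -[_ *m ursubmx M *m h]mulmxA urh -scalar_mxM -/a.
move: (h^t* *m _ *m h) => X.
rewrite !mxE /= !mulr1n.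
have ReJ u : Re (u^*%C) = Re u by case: u.
have ReD (u v : R[i]) : Re (u + v) = Re u + Re v by case: u; case: v.
have ReN (u : R[i]) : Re (- u) = - Re u by case: u.
rewrite !ReD ReN (_ : Re (w^*%C * z) = Re (z^*%C * w)); last first.
  by rewrite -ReJ rmorphM /= conjcK mulrC.
rewrite (_ : z^*%C * a * z = a * (z^*%C * z)); last by ring.
ring.
Qed.

Lemma hermitian_diag d (M : 'M[R[i]]_d) k : M^t* = M -> M k k = (Re (M k k))%:C.
Proof.
move=> Mh; have : (M k k)^*%C = M k k by rewrite -{2}Mh !mxE.
by case: (M k k) => a b [] bb; congr (_ +i* _); lra.
Qed.

Lemma posdefmx_diag_gt0 d (M : 'M[R[i]]_d) k : posdefmx M -> 0 < Re (M k k).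
Proof.
move=> [Mh Mpos]; have := Mpos (delta_mx k 0).
rewrite /qform trmx_delta map_delta_mx -rowE -colE !mxE; apply.
by apply/eqP => /matrixP /(_ k 0); rewrite !mxE !eqxx /= => /eqP; rewrite oner_eq0.
Qed.

Lemma posdefmx_diag_neq0 d (M : 'M[R[i]]_d) k : posdefmx M -> M k k != 0.
Proof. by move=> /(posdefmx_diag_gt0 k); apply: contraTneq => ->; rewrite ltxx. Qed.

Lemma schur_compl_hermitian d (M : 'M[R[i]]_(1 + d)) :
  M^t* = M -> (schur_compl M)^t* = schur_compl M.
Proof.
move=> Mh; apply/matrixP => i j.
rewrite /schur_compl !mxE rmorphB rmorphM /= !big_ord1 !mxE.
rewrite rmorphM fmorphV /=.
have MC k l : (M k l)^* = M l k by rewrite -[in LHS]Mh !mxE conjcK.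
by rewrite [X in _ = _ - _ * X]mulrC; congr (_ - _^-1 * (_ * _)); apply: MC.
Qed.

Lemma posdefmx_schur_compl d (M : 'M[R[i]]_(1 + d)) :
  posdefmx M -> posdefmx (schur_compl M).
Proof.
move=> Mp; have [Mh Mpos] := Mp; split; first exact: schur_compl_hermitian.
move=> h h0; have a0 := posdefmx_diag_neq0 0 Mp.
set w := (ursubmx M *m h) 0 0.
have MC k l : (M k l)^*%C = M l k by rewrite -[in LHS]Mh !mxE conjcK.
(* The first coordinate -w / a, with pivot a = [M 0 0], completes the square: every term but the
   form of the Schur complement cancels. *)
have := Mpos (col_mx (- (w / M 0 0))%:M h).
have zJ : (- (w / M 0 0))^*%C = - (w^*%C / M 0 0).
  by rewrite rmorphN rmorphM fmorphV; congr (- (_ * _^-1)); apply: MC.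
rewrite qform_col_mx // -/w zJ.
set q := qform (schur_compl M) h.
rewrite (_ : _ + _ = q); last first.
  rewrite (_ : M 0 0 * _ = (M 0 0)^-1 * (w^*%C * w)); last by field.
  rewrite (_ : - (w^*%C / M 0 0) * w = - ((M 0 0)^-1 * (w^*%C * w))); last by field.
  by case: (_^-1 * _) => x y /=; ring.
by apply; apply: contraNneq h0 => /(congr1 dsubmx); rewrite col_mxKd linear0 => ->.
Qed.

Lemma real_mul_normE (a : R) w :
  Re (a%:C * (w^*%C * w)) = a * (Re w ^+ 2 + Im w ^+ 2).
Proof. by case: w => x y /=; ring. Qed.

(** Elimination subtracts |M_0k|^2 / a from the diagonal, so the bound by 1 survives the induction
    in [phase_mgf]. *)
Lemma schur_compl_diag_le d (M : 'M[R[i]]_(1 + d)) k :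
  posdefmx M -> Re (schur_compl M k k) <= Re (M (rshift 1 k) (rshift 1 k)).
Proof.
move=> Mp; have [Mh _] := Mp.
rewrite /schur_compl !mxE big_ord1 !mxE (hermitian_diag 0) //.
have := posdefmx_diag_gt0 0 Mp; set a := Re _ => a0.
have -> : M (rshift 1 k) (lshift d ord0) = (M (lshift d ord0) (rshift 1 k))^*%C.
  by rewrite -[in LHS]Mh !mxE.
have -> : (a%:C)^-1 = (a^-1)%:C by rewrite fmorphV.
set z := M (lshift d ord0) _.
have ReB (u v : R[i]) : Re (u - v) = Re u - Re v by case: u; case: v.
rewrite ReB real_mul_normE gerBl mulr_ge0 ?addr_ge0 ?sqr_ge0 //.
by rewrite invr_ge0 ltW.
Qed.

Lemma sum_phases_col_mx d (F : 'cV[R[i]]_(1 + d) -> R) :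
  \sum_(g : 'cV['I_4]_(1 + d)) F (map_mx phase g) =
  \sum_(h : 'cV['I_4]_d) \sum_k F (col_mx (phase k)%:M (map_mx phase h)).
Proof.
rewrite pair_big /=.
rewrite (reindex (fun p : 'cV['I_4]_d * 'I_4 => col_mx (const_mx p.2 : 'cV_1) p.1)) /=.
  apply: eq_bigr => -[h k] _ /=; congr F; rewrite map_col_mx; congr col_mx.
  by apply/matrixP=> i j; rewrite !mxE !ord1 eqxx mulr1n.
exists (fun g => (dsubmx g, g (lshift d 0) 0)) => [[h k] _|g _] /=.
  by rewrite col_mxKd; congr (_, _); rewrite col_mxEu mxE.
rewrite -[RHS]vsubmxK; congr col_mx; apply/matrixP=> i j.
by rewrite !mxE !ord1.
Qed.

(* Induction by Schur complements. Averaging over the first phase produces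
   exp |w|^2 <= exp (|w|^2 / a), where a <= 1 is the first pivot; this is exactly
   what turns the form of M into that of its Schur complement. The factor
   exp (1 - a) <= 1 / a then accumulates to 1 / det M. *)
Lemma phase_mgf d (M : 'M[R[i]]_d) :
  posdefmx M -> (forall k, Re (M k k) <= 1) ->
  exists2 D : R, 0 < D /\ \det M = D%:C &
    \sum_(g : 'cV['I_4]_d) expR (- qform M (map_mx phase g))
      <= 4 ^+ d * expR (- d%:R) / D.
Proof.
elim: d M => [|d IH] M Mp Md.
  exists 1; first by rewrite det_mx00.
  rewrite expr0 mul1r invr1 mulr1 oppr0 expR0.
  rewrite (eq_bigr (fun=> 1)) => [|g _].
    by rewrite sumr_const card_mx card_ord mul0n expn0.
  rewrite /qform (_ : _ 0 0 = 0) ?oppr0 ?expR0 // mxE big1 // => -[] //.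
have Mp' : posdefmx (M : 'M_(1 + d)) by [].
have Md' (k : 'I_(1 + d)) : Re (M k k) <= 1 by apply: Md.
have [D [D0 detD] HD] := IH (schur_compl (M : 'M_(1 + d)))
  (posdefmx_schur_compl Mp') (fun k => le_trans (schur_compl_diag_le k Mp') (Md' _)).
have [Mh _] := Mp'.
have a0 : 0 < Re (M 0 0) by apply: (posdefmx_diag_gt0 0 Mp').
have aE := hermitian_diag 0 Mh.
have a1 := Md' 0.
set a := Re (M 0 0) in a0 aE a1.
have aV : (a%:C)^-1 = (a^-1)%:C by rewrite fmorphV.
have aC : M 0 0 != 0 := posdefmx_diag_neq0 0 Mp'.
exists (a * D); first by rewrite mulr_gt0 // det_schur_compl // detD aE -rmorphM.
rewrite [leLHS](sum_phases_col_mx (fun v => expR (- qform (M : 'M_(1 + d)) v))).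
have step (h : 'cV['I_4]_d) :
    \sum_k expR (- qform (M : 'M_(1 + d)) (col_mx (phase k)%:M (map_mx phase h)))
    <= 4 * expR (- a) * expR (- qform (schur_compl M) (map_mx phase h)).
  set v := map_mx phase h; set w := (ursubmx (M : 'M_(1 + d)) *m v) 0 0.
  set N := Re w ^+ 2 + Im w ^+ 2.
  have N0 : 0 <= N by rewrite addr_ge0 ?sqr_ge0.
  rewrite (eq_bigr (fun k => expR (- a - qform (schur_compl M) v - a^-1 * N)
      * expR (- (Re ((phase k)^*%C * w) *+ 2)))) => [|k _].
    rewrite -mulr_sumr.
    apply: le_trans (ler_wpM2l (expR_ge0 _) (phase_sum w)) _.
    rewrite -/N mulrCA -mulrA -!expRD ler_wpM2l // ler_expR.
    suff : N <= a^-1 * N by lra.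
    by rewrite ler_peMl // invf_ge1.
  rewrite -expRD qform_col_mx // phase_norm mulr1 -/w aE aV real_mul_normE -/N /=.
  by congr expR; ring.
apply: le_trans (ler_sum _ (fun h _ => step h)) _.
rewrite -mulr_sumr; apply: le_trans (ler_wpM2l _ HD) _.
  by rewrite mulr_ge0 ?expR_ge0.
rewrite [leLHS](_ : _ = 4 ^+ d.+1 * expR (- d%:R) / D * expR (- a)); last first.
  by rewrite exprS; ring.
rewrite [leRHS](_ : _ = 4 ^+ d.+1 * expR (- d%:R) / D * (expR (- 1) / a)); last first.
  by rewrite -(natr1 d) opprD expRD; field; rewrite !gt_eqF.
apply: ler_wpM2l.
  by apply: divr_ge0 (ltW D0); rewrite mulr_ge0 ?expR_ge0 ?exprn_ge0.
rewrite ler_pdivlMr //.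
rewrite (_ : -1 = -a + (a - 1)); last by ring.
rewrite expRD ler_wpM2l ?expR_ge0 //.
by have := expR_ge1Dx (a - 1); lra.
Qed.

End PhaseMgf.

(** Both sides are the determinant of the block matrix [X], factored in two ways. It turns a d x d
    determinant into an r x r one in [projector_mgf]. *)
Lemma det_1subM (K : comNzRingType) m n (A : 'M[K]_(m, n)) (B : 'M[K]_(n, m)) :
  \det (1%:M - A *m B) = \det (1%:M - B *m A).
Proof.
pose X := block_mx 1%:M B A 1%:M.
have X1 : \det X = \det (1%:M - A *m B).
  have -> : X = block_mx 1%:M 0 A 1%:M *m block_mx 1%:M B 0 (1%:M - A *m B).
    rewrite mulmx_block !(mul0mx, mulmx0, mul1mx, mulmx1) !(addr0, add0r).
    by rewrite addrC subrK.
  by rewrite det_mulmx det_lblock det_ublock !det1 !mul1r.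
rewrite -X1.
have -> : X = block_mx (1%:M - B *m A) B 0 1%:M *m block_mx 1%:M 0 A 1%:M.
  rewrite mulmx_block !(mul0mx, mulmx0, mul1mx, mulmx1) !(addr0, add0r).
  by rewrite subrK.
by rewrite det_mulmx det_lblock det_ublock !det1 !mulr1.
Qed.

(** * Exponential moment of the squared norm of a projected random vector *)

Section Projector.
Variable R : realType.

Definition sqnorm m n (A : 'M[R[i]]_(m, n)) : R :=
  \sum_i \sum_j (Re (A i j) ^+ 2 + Im (A i j) ^+ 2).

Lemma sqnorm_ge0 m n (A : 'M[R[i]]_(m, n)) : 0 <= sqnorm A.
Proof. by do 2!(apply: sumr_ge0 => ? _); rewrite addr_ge0 ?sqr_ge0. Qed.

Lemma sqnorm_eq0 m n (A : 'M[R[i]]_(m, n)) : sqnorm A = 0 -> A = 0.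
Proof.
move=> /eqP; rewrite psumr_eq0 => [/allP A0|i _]; last first.
  by apply: sumr_ge0 => ? _; rewrite addr_ge0 ?sqr_ge0.
apply/matrixP => i j; have := A0 i (mem_index_enum _).
rewrite /= psumr_eq0 => [/allP /(_ j (mem_index_enum _))|? _]; last first.
  by rewrite addr_ge0 ?sqr_ge0.
rewrite /= paddr_eq0 ?sqr_ge0 // !sqrf_eq0 mxE => /andP[/eqP ? /eqP ?].
by apply/eqP; rewrite eq_complex; apply/andP; split; apply/eqP.
Qed.

Lemma trace_mulCmx m n (A : 'M[R[i]]_(m, n)) : \tr (A^t* *m A) = (sqnorm A)%:C.
Proof.
rewrite /mxtrace /sqnorm exchange_big rmorph_sum; apply: eq_bigr => j _ /=.
rewrite mxE rmorph_sum; apply: eq_bigr => i _ /=; rewrite !mxE.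
by rewrite add_Re2_Im2 sqr_normc mulrC.
Qed.

Lemma qform_mulCmx m d (X : 'M[R[i]]_(m, d)) v :
  qform (X^t* *m X) v = sqnorm (X *m v).
Proof.
rewrite -[RHS]/(Re (sqnorm (X *m v))%:C) -trace_mulCmx /mxtrace big_ord1.
by rewrite trmx_mul map_mxM /qform !mulmxA.
Qed.

Lemma trmxCB m n (A B : 'M[R[i]]_(m, n)) : (A - B)^t* = A^t* - B^t*.
Proof. by apply/matrixP => i j; rewrite !mxE rmorphB. Qed.

Lemma trmxCZ m n (a : R) (A : 'M[R[i]]_(m, n)) : (a%:C *: A)^t* = a%:C *: A^t*.
Proof.
by apply/matrixP => i j; rewrite !mxE rmorphM /=; congr (_ * _); apply: conjc_real.
Qed.

Lemma qform1 d (v : 'cV[R[i]]_d) : qform 1%:M v = sqnorm v.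
Proof. by rewrite -[in RHS](mul1mx v) -qform_mulCmx trmx1 map_mx1 mul1mx. Qed.

Lemma qformB d (A B : 'M[R[i]]_d) v : qform (A - B) v = qform A v - qform B v.
Proof.
rewrite /qform mulmxBr mulmxBl !mxE.
by case: (\sum_j _) => ? ?; case: (\sum_j _) => ? ?.
Qed.

Lemma qformZ d (a : R) (A : 'M[R[i]]_d) v : qform (a%:C *: A) v = a * qform A v.
Proof.
rewrite /qform -scalemxAr -scalemxAl !mxE.
by case: (\sum_j _) => ? ? /=; rewrite mul0r subr0.
Qed.

Lemma sqnorm_phase d (g : 'cV['I_4]_d) : sqnorm (map_mx (@phase R) g) = d%:R.
Proof.
apply: complexI; rewrite -trace_mulCmx /mxtrace big_ord1 mxE.
rewrite (eq_bigr (fun=> 1)) => [|k _]; last by rewrite !mxE phase_norm.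
by rewrite sumr_const card_ord rmorph_nat.
Qed.

(** Apply [phase_mgf] to M = 1 - lam P: since |g|^2 = d for every phase vector, the factor exp(-d)
    cancels, and det M = (1 - lam)^r. *)
Lemma projector_mgf r d (V : 'M[R[i]]_(r, d)) (lam : R) :
  V *m V^t* = 1%:M -> 0 <= lam -> lam < 1 ->
  \sum_(g : 'cV['I_4]_d) expR (lam * sqnorm (V *m map_mx (@phase R) g))
    <= 4 ^+ d / (1 - lam) ^+ r.
Proof.
move=> VV lam0 lam1.
pose P := V^t* *m V; pose M := 1%:M - lam%:C *: P.
have Ph : P^t* = P by rewrite /P trmx_mul map_mxM trmxCK.
have PP : P *m P = P by rewrite /P mulmxA -[V^t* *m V *m V^t*]mulmxA VV mulmx1.
have qM v : qform M v = sqnorm v - lam * sqnorm (V *m v).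
  by rewrite qformB qformZ qform_mulCmx qform1.
(* Splitting v along P and 1 - P shows the form as a sum of nonnegative terms that vanish together
   only at v = 0. *)
have qM2 v : qform M v = (1 - lam) * sqnorm (V *m v) + sqnorm ((1%:M - P) *m v).
  rewrite -[sqnorm ((_ - _) *m v)]qform_mulCmx.
  have -> : (1%:M - P)^t* *m (1%:M - P) = 1%:M - P.
    rewrite trmxCB Ph trmx1 map_mx1 mulmxBl mul1mx mulmxBr PP mulmx1.
    by rewrite subrr subr0.
  rewrite qM qformB qform_mulCmx qform1.
  ring.
have Mpos : posdefmx M.
  split=> [|v v0].
    by rewrite /M trmxCB trmxCZ Ph trmx1 map_mx1.
  rewrite lt_neqAle eq_sym; apply/andP; split; last first.
    by rewrite qM2 addr_ge0 ?mulr_ge0 ?sqnorm_ge0 // subr_ge0 ltW.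
  apply: contraNneq v0 => /eqP.
  rewrite qM2 paddr_eq0 ?mulr_ge0 ?sqnorm_ge0 ?subr_ge0 ?(ltW lam1) //.
  rewrite mulf_eq0 subr_eq0 (gt_eqF lam1) /= => /andP[/eqP/sqnorm_eq0 Vv /eqP/sqnorm_eq0].
  by rewrite mulmxBl mul1mx -[P *m v]mulmxA Vv mulmx0 subr0 => ->.
have Mdiag k : Re (M k k) <= 1.
  have Pk : P k k = (sqnorm (col k V))%:C.
    rewrite -trace_mulCmx /mxtrace big_ord1 !mxE; apply: eq_bigr => i _.
    by rewrite !mxE.
  have -> : M k k = 1 - lam%:C * P k k.
    by rewrite [LHS]mxE mxE eqxx; congr (_ + _); rewrite mxE mxE.
  rewrite Pk -rmorphM /=.
  by rewrite gerBl mulr_ge0 ?sqnorm_ge0.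
have [D [D0 detD] ] := phase_mgf Mpos Mdiag.
have {detD} -> : D = (1 - lam) ^+ r.
  apply: complexI; rewrite -detD /M /P scalemxAl det_1subM -scalemxAr VV.
  by rewrite scalemx1 -raddfB det_scalar rmorphXn rmorphB.
rewrite (eq_bigr (fun g : 'cV_d => expR (- d%:R) *
   expR (lam * sqnorm (V *m map_mx (@phase R) g)))) => [|g _]; last first.
  by rewrite qM sqnorm_phase -expRD opprB addrC.
rewrite -mulr_sumr mulrAC [leRHS]mulrC => H.
by move: H; rewrite ler_pM2l // expR_gt0.
Qed.

End Projector.

(** * Independent sets in sparse digraphs *)

(** Inside [S] the in-degrees and the out-degrees have the same sum, at most D |S|, so the average
    total degree is at most 2D. *)
Lemma exists_low_degree (T : finType) (bad : rel T) D (S : {set T}) :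
  (forall a, #|[set b | bad a b]| <= D)%N -> (0 < #|S|)%N ->
  exists2 a, a \in S & (#|[set b in S | bad a b || bad b a]| <= D.*2)%N.
Proof.
move=> outD S0; apply/exists_inP; rewrite -[X in is_true X]negbK negb_exists_in.
apply/forall_inP => high.
have sumE : (\sum_(a in S) #|[set b in S | bad b a]|
    = \sum_(a in S) #|[set b in S | bad a b]|)%N.
  transitivity (\sum_(a in S) \sum_(b in S) bad b a)%N.
    apply: eq_bigr => a _; rewrite -sum1_card big_mkcond [RHS]big_mkcond /=.
    by apply: eq_bigr => b _; rewrite inE; case: (b \in S); case: (bad b a).
  rewrite exchange_big; apply: eq_bigr => a _.
  rewrite -[RHS]sum1_card [RHS]big_mkcond [LHS]big_mkcond /=.
  by apply: eq_bigr => b _; rewrite inE; case: (b \in S); case: (bad a b).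
have out_le : (\sum_(a in S) #|[set b in S | bad a b]| <= D * #|S|)%N.
  rewrite mulnC -sum_nat_const; apply: leq_sum => a _; apply: leq_trans (outD a).
  by apply: subset_leq_card; apply/fintype.subsetP => b; rewrite !inE => /andP[].
have : (D.*2.+1 * #|S| <= \sum_(a in S)
    (#|[set b in S | bad a b]| + #|[set b in S | bad b a]|))%N.
  rewrite mulnC -sum_nat_const; apply: leq_sum => a aS.
  have := high a aS; rewrite -ltnNge => /leq_trans; apply.
  apply: leq_trans (leq_card_setU _ _); apply: subset_leq_card; apply/fintype.subsetP => b.
  by rewrite !inE -andb_orr.
rewrite big_split /= sumE addnn => /leq_trans/(_ (_ : _ <= (D * #|S|).*2)%N).
rewrite leq_double => /(_ out_le).
by rewrite doubleMl mulSn -[leqRHS]add0n leq_add2r leqNgt S0.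
Qed.

(** Greedy choice: each selected vertex discards itself and at most 2D neighbours, so N rounds
    consume at most N (2D + 1) vertices. *)
Lemma sparse_rel_independent (T : finType) (bad : rel T) D N :
  (forall a, #|[set b | bad a b]| <= D)%N -> (N * D.*2.+1 <= #|T|)%N ->
  exists f : 'I_N -> T, forall i j, i != j -> ~~ bad (f i) (f j).
Proof.
move=> outD.
have step : forall (S : {set T}), (N * D.*2.+1 <= #|S|)%N -> exists2 s : seq T,
    size s = N /\ {subset s <= S} & pairwise (fun a b => ~~ (bad a b || bad b a)) s.
  elim: N => [|N IH] S SN; first by exists [::].
  have [|a aS adeg] := @exists_low_degree _ bad D S outD.
    by apply: leq_trans SN; rewrite mulSn.
  have [|s [sN sS] sP] := IH (S :\: (a |: [set b in S | bad a b || bad b a])).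
    have := cardsID (a |: [set b in S | bad a b || bad b a]) S.
    set X := #|S :&: _|; set Y := #|S :\: _| => XY.
    have XD : (X <= D.*2.+1)%N.
      rewrite /X; apply: leq_trans (subset_leq_card (subsetIr _ _)) _.
      apply: leq_trans (leq_card_setU _ _) _; rewrite cards1 add1n ltnS //.
    by rewrite -(leq_add2l D.*2.+1) -mulSn (leq_trans SN) // -XY leq_add2r.
  exists (a :: s) => /=.
    split; first by rewrite sN.
    by move=> b; rewrite inE => /orP[/eqP->//|/sS]; rewrite inE => /andP[].
  rewrite sP andbT; apply/allP => b /sS; rewrite !inE negb_or => /andP[/andP[_]].
  by move=> + bS; rewrite bS.
rewrite -cardsT => /step [s [sN _] sP].
(* [nth] needs a default element, and [T] may be empty when N = 0. *)
case: s => [|x0 s'] in sN sP *.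
  have f0 : 'I_0 -> T by case.
  by rewrite -sN; exists f0 => -[].
set s := x0 :: s' in sN sP.
exists (fun i : 'I_N => nth x0 s i) => i j ij.
have lt_good (k l : 'I_N) : (k < l)%N ->
    ~~ (bad (nth x0 s k) (nth x0 s l) || bad (nth x0 s l) (nth x0 s k)).
  by move=> kl; apply: (pairwiseP x0 sP) => //; rewrite inE sN.
have := ij; rewrite -val_eqE neq_ltn => /orP[] /lt_good; rewrite negb_or => /andP[] //.
Qed.

(** * Tail bound for random phase matrices *)

Section Tail.
Variable R : realType.

(** Indexing by a finite function of columns makes the sample space a product over columns, which
    expresses their independence. *)
Definition phase_mx r d (f : {ffun 'I_r -> 'cV['I_4]_d}) : 'M[R[i]]_(d, r) :=
  \matrix_(i, l) phase R (f l i 0).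

Lemma sqnorm_mul_phase_mx r d m (V : 'M[R[i]]_(m, d)) (f : {ffun 'I_r -> 'cV['I_4]_d}) :
  sqnorm (V *m phase_mx f) = \sum_l sqnorm (V *m map_mx (@phase R) (f l)).
Proof.
rewrite /sqnorm exchange_big; apply: eq_bigr => l _; apply: eq_bigr => i _.
rewrite big_ord1 !mxE.
by congr (Re _ ^+ 2 + Im _ ^+ 2); apply: eq_bigr => k _; rewrite !mxE.
Qed.

Lemma sqnorm_phase_mx r d (f : {ffun 'I_r -> 'cV['I_4]_d}) :
  sqnorm (phase_mx f) = (r * d)%:R.
Proof.
rewrite -[phase_mx f]mul1mx sqnorm_mul_phase_mx.
rewrite (eq_bigr (fun=> d%:R)) => [|l _]; last by rewrite mul1mx sqnorm_phase.
by rewrite sumr_const card_ord natrM mulr_natl.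
Qed.

(** Markov's inequality for exp(lam |V G|^2), in counting form. *)
Lemma projector_tail m r d (V : 'M[R[i]]_(m, d)) (lam c : R) :
  V *m V^t* = 1%:M -> 0 <= lam -> lam < 1 ->
  #|[set f : {ffun 'I_r -> 'cV['I_4]_d} | c < sqnorm (V *m phase_mx f)]|%:R
    * expR (lam * c) <= (4 ^+ d / (1 - lam) ^+ m) ^+ r.
Proof.
move=> VV lam0 lam1.
apply: (@le_trans _ _ (\sum_(f : {ffun 'I_r -> 'cV['I_4]_d})
  expR (lam * sqnorm (V *m phase_mx f)))).
  rewrite mulr_natl -sumr_const [leLHS]big_mkcond; apply: ler_sum => f _ /=.
  rewrite inE; case: ifP => [cf|_]; last exact: expR_ge0.
  by rewrite ler_expR ler_wpM2l // ltW.
under eq_bigr do rewrite sqnorm_mul_phase_mx mulr_sumr expR_sum.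
(* Independence of the columns: the sum over matrices of a product over columns is a product of
   sums, each bounded by [projector_mgf]. *)
rewrite -(bigA_distr_bigA (fun (_ : 'I_r) g =>
  expR (lam * sqnorm (V *m map_mx (@phase R) g)))) /=.
rewrite prodr_const card_ord; apply: lerXn2r; rewrite ?nnegrE.
- by apply: sumr_ge0 => g _; apply: expR_ge0.
- by rewrite divr_ge0 ?exprn_ge0 // subr_ge0 ltW.
exact: projector_mgf.
Qed.

End Tail.

(** * Psd-factorizations built from projectors *)

Section Factorization.
Variable R : realType.

Lemma psdmx_gram m d (a : R) (X : 'M[R[i]]_(m, d)) :
  0 <= a -> psdmx (a%:C *: (X^t* *m X)).
Proof.
move=> a0; split=> [|v].
  apply/is_hermitianmxP; rewrite expr0 scale1r trmxCZ trmx_mul map_mxM.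
  by congr (_ *: (_ *m _)); apply/esym/trmxCK.
rewrite -scalemxAr -scalemxAl mxE mulr_ge0 ?ler0c //.
have -> : v^t* *m (X^t* *m X) *m v = (X *m v)^t* *m (X *m v).
  by rewrite trmx_mul map_mxM !mulmxA.
by rewrite -trace_mx11 trace_mulCmx ler0c sqnorm_ge0.
Qed.

Lemma approx_psd_rank_le (eps : R) m n d (M M' : 'M[R]_(m, n)) :
  nonnegmx M' -> (forall i j, `|M' i j - M i j| <= eps) ->
  psd_factorizable M' d -> (approx_psd_rank eps M <= d)%N.
Proof.
move=> M'0 near fact.
have [_ /(_ (psd_rank M'))] : psd_ranks_near eps M (approx_psd_rank eps M) /\
    forall k, psd_ranks_near eps M k -> (approx_psd_rank eps M <= k)%N.
  by apply: nat_minP; exists (psd_rank M'), M'.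
move=> /(_ _)/leq_trans; apply; first by exists M'.
by have [_] := nat_minP (ex_intro _ d fact); apply.
Qed.

Lemma projector_factorization N r d (V : 'I_N -> 'M[R[i]]_(r, d))
    (G : 'I_N -> 'M[R[i]]_(d, r)) (a : R) : 0 <= a ->
  psd_factorizable (\matrix_(i, j) (a * sqnorm (V i *m G j))) d.
Proof.
move=> a0; exists (fun i => (V i)^t* *m V i), (fun j => a%:C *: (G j *m (G j)^t*)).
split=> [i|j|i j].
- by rewrite -[_ *m _]scale1r; apply: psdmx_gram.
- have := psdmx_gram ((G j)^t*) a0; rewrite (_ : (G j)^t*^t* = G j) //; exact: trmxCK.
rewrite mxE -scalemxAr mxtraceZ rmorphM; congr (_ * _).
rewrite mulmxA mxtrace_mulC mulmxA; apply: etrans (esym (trace_mulCmx _)) _; congr (\tr _).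
by rewrite trmx_mul map_mxM !mulmxA.
Qed.

(* [schmidt] returns r orthonormal rows even when [G^t*] is rank deficient; their
   span only contains the row space of [G^t*]. *)
Definition range_frame r d (G : 'M[R[i]]_(d, r)) : 'M[R[i]]_(r, d) := schmidt (G^t*).

Lemma range_frame_unitary r d (G : 'M[R[i]]_(d, r)) :
  (r <= d)%N -> range_frame G *m (range_frame G)^t* = 1%:M.
Proof. by move=> rd; apply/unitarymxP/schmidt_unitarymx. Qed.

(** Write V for the frame. From G^* = D V and V V^* = 1 one gets G^* V^* V = G^*, so projecting does
    not shorten G. *)
Lemma sqnorm_range_frame r d (G : 'M[R[i]]_(d, r)) :
  (r <= d)%N -> sqnorm (range_frame G *m G) = sqnorm G.
Proof.
move=> rd; apply: complexI; rewrite -!trace_mulCmx.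
have /submxP[D GD] := schmidt_sub (G^t*).
have -> : (range_frame G *m G)^t* *m (range_frame G *m G)
    = G^t* *m (range_frame G)^t* *m range_frame G *m G.
  by rewrite trmx_mul map_mxM !mulmxA.
congr (\tr (_ *m _)); rewrite GD -/(range_frame G).
by rewrite -[D *m _ *m _]mulmxA range_frame_unitary // mulmx1.
Qed.

(** Lets the tail at lam = 3/4 be counted in powers of 2. It follows from exp t >= 1 + t at t =
    3/32, raised to the eighth power. *)
Lemma expR_three_quarters_ge2 : 2 <= expR (3 / 4 : R).
Proof.
have -> : expR (3 / 4 : R) = expR (3 / 32) ^+ 8.
  by rewrite -expRM_natl; congr expR; field.
apply: le_trans (_ : (35 / 32) ^+ 8 <= _); first by lra.
by apply: lerXn2r; rewrite ?nnegrE ?expR_ge0 //; have := expR_ge1Dx (3 / 32 : R); lra.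
Qed.

Lemma approx_psd_rank_id_le n r d (eps : R) : (0 < r)%N -> (r <= d)%N ->
  0 < eps -> eps <= 1 ->
  (2 * r ^ 2 + n + 2)%:R <= eps * (r * d)%:R ->
  (approx_psd_rank eps (1%:M : 'M[R]_(2 ^ n)) <= d)%N.
Proof.
move=> r0 rd eps0 eps1 large.
set c := eps * (r * d)%:R in large.
have rd0 : (0 < r * d)%N by rewrite muln_gt0 r0 (leq_trans r0).
(* Ensures that the natural-number subtraction in the degree bound below is not truncated. *)
have rd_large : (n + 2 <= 2 * (d * r))%N.
  have : (2 * r ^ 2 + n + 2)%:R <= (r * d)%:R :> R.
    by apply: le_trans large _; rewrite ler_piMl.
  by rewrite ler_nat; lia.
pose bad (a b : {ffun 'I_r -> 'cV['I_4]_d}) :=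
  c < sqnorm (range_frame (phase_mx R a) *m phase_mx R b).
(* There are 4^(rd) = 2^(2rd) phase matrices; the out-degree bound D is the fraction 2^(-n-2) of
   them. *)
have [||f fP] := @sparse_rel_independent _ bad (2 ^ (2 * (d * r) - (n + 2))) (2 ^ n).
- move=> a; have := @projector_tail R r r d (range_frame (phase_mx R a)) (3 / 4) c
    (range_frame_unitary _ rd).
  have -> : 0 <= 3 / 4 :> R by lra.
  have -> : 3 / 4 < 1 :> R by lra.
  move=> /(_ isT isT); set K := #|_| => HK.
  (* The left power of 2 is a lower bound for exp(3c/4), by the hypothesis on c; the right one is
     (4^d 4^r)^r, as 1 - lam = 1/4. *)
  have HK2 : K%:R * 2 ^+ (2 * r ^ 2 + n + 2) <= 2 ^+ (2 * (d * r) + 2 * r ^ 2) :> R.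
    apply: le_trans (_ : _ <= K%:R * expR (3 / 4 * c)) _.
      rewrite ler_wpM2l // (le_trans (_ : _ <= expR (3 / 4) ^+ (2 * r ^ 2 + n + 2))) //.
        by rewrite lerXn2r ?nnegrE ?expR_ge0 // expR_three_quarters_ge2.
      by rewrite -expRM_natl ler_expR mulrC ler_wpM2l //; lra.
    apply: le_trans HK _.
    rewrite (_ : 1 - 3 / 4 = 4^-1); last by field.
    rewrite exprVn invrK -exprD -exprM (_ : 4 = 2 ^+ 2 :> R) -?exprM; last by ring.
    by rewrite (_ : (2 * ((d + r) * r) = 2 * (d * r) + 2 * r ^ 2)%N) //; ring.
  have {}HK2 : (K * 2 ^ (2 * r ^ 2 + n + 2) <= 2 ^ (2 * (d * r) + 2 * r ^ 2))%N.
    by rewrite -(ler_nat R) natrM !natrX.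
  rewrite -(@leq_pmul2r (2 ^ (2 * r ^ 2 + n + 2))) ?expn_gt0 //.
  apply: leq_trans HK2 _.
  by rewrite -expnD leq_exp2l //; lia.
- rewrite card_ffun card_mx !card_ord muln1.
  (* Here 2D + 1 <= 4D, so 2^n greedy rounds fit. *)
  apply: leq_trans (_ : 2 ^ n * 2 ^ (2 * (d * r) - (n + 2)).+2 <= _)%N.
    rewrite leq_mul2l; apply/orP; right.
    by rewrite !expnS; have := expn_gt0 2 (2 * (d * r) - (n + 2)); lia.
  by rewrite -expnD -expnM (_ : 4 = 2 ^ 2)%N // -expnM leq_exp2l //; lia.
pose G i := phase_mx R (f i); pose V i := range_frame (G i).
have rdR : 0 < (r * d)%:R :> R by rewrite ltr0n.
(* All entries of G have modulus 1, so |G|^2 = rd and the scaling by 1 / (rd) makes the diagonal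
   exactly 1. *)
apply: approx_psd_rank_le (projector_factorization V G (_ : 0 <= (r * d)%:R^-1)).
- by move=> i j; rewrite mxE mulr_ge0 ?sqnorm_ge0 // invr_ge0 ltW.
- move=> i j; rewrite !mxE; have [<-|ij] := eqVneq i j.
    rewrite sqnorm_range_frame // sqnorm_phase_mx mulVf ?gt_eqF //.
    by rewrite subrr normr0 ltW.
  rewrite subr0 ger0_norm ?mulr_ge0 ?sqnorm_ge0 ?invr_ge0 ?(ltW rdR) //.
  rewrite mulrC ler_pdivrMr // -/c.
  by have := fP i j ij; rewrite /bad -leNgt.
by rewrite invr_ge0 ltW.
Qed.

Lemma approx_psd_rank_id_trivial N (eps : R) : 0 <= eps ->
  (approx_psd_rank eps (1%:M : 'M[R]_N) <= N)%N.
Proof.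
move=> eps0; pose V (i : 'I_N) : 'M[R[i]]_(1, N) := delta_mx 0 i.
pose G (j : 'I_N) : 'M[R[i]]_(N, 1) := delta_mx j 0.
have fact := projector_factorization V G ler01.
have idE : \matrix_(i, j) (1 * sqnorm (V i *m G j)) = 1%:M.
  apply/matrixP => i j; rewrite !mxE mul1r mul_delta_mx_cond /sqnorm !big_ord1.
  by case: (i == j); rewrite ?mulr1n ?mulr0n !mxE /= ?expr1n expr0n addr0.
rewrite idE in fact; apply: approx_psd_rank_le fact.
- by move=> i j; rewrite mxE ler0n.
- by move=> i j; rewrite subrr normr0.
Qed.

End Factorization.

Theorem corollary1p12 (R : realType) (n : nat) (hn : (0 < n)%N) (eps : R)
    (heps0 : 0 < eps) (heps1 : eps < 1 / 2) :
  (approx_psd_rank eps (1%:M : 'M[R]_(2 ^ n)%N))%:R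
    <= 4 * Num.sqrt (n%:R : R) / eps.
Proof.
set s := Num.sqrt (n%:R : R).
have s0 : 0 <= s by apply: sqrtr_ge0.
have s2 : s ^+ 2 = n%:R by rewrite sqr_sqrtr.
have s_ge (k : nat) : (k ^ 2 <= n)%N -> k%:R <= s.
  by move=> kn; rewrite -(@ler_pXn2r _ 2) ?nnegrE // s2 -natrX ler_nat.
(* This is where eps < 1/2 gives the bound needed for n < 4, where 2^n <= 8 and s >= 1. *)
have bound : 8 * s <= 4 * s / eps by rewrite ler_pdivlMr //; nra.
have [n4|n3] := leqP 4 n; last first.
  apply: le_trans bound; apply: le_trans (_ : (2 ^ n)%:R <= _).
    by rewrite ler_nat approx_psd_rank_id_trivial // ltW.
  have s1 : 1 <= s by apply: (s_ge 1%N).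
  apply: le_trans (_ : 8 <= _); last by lra.
  by rewrite (ler_nat _ _ 8) (@leq_pexp2l 2 n 3).
have s_ge2 : 2 <= s by apply: (s_ge 2%N).
set x := 4 * s / eps.
have x0 : 0 <= x by rewrite /x divr_ge0 ?mulr_ge0 // ltW.
have := truncn_itv s0; set r := Num.truncn s => /andP[rs sr].
have := truncn_itv x0; set d := Num.truncn x => /andP[dx xd].
apply: le_trans dx; rewrite ler_nat.
rewrite -(natr1 r) in sr; rewrite -(natr1 d) in xd.
have r2 : (2 <= r)%N.
  by rewrite -ltnS -(ltr_nat R) -(natr1 r); apply: le_lt_trans s_ge2 sr.
have r2R : 2 <= r%:R :> R by rewrite (ler_nat _ 2).
(* Rounding x down to d costs less than eps, hence less than 1/2, in eps d. *)
have epsd : 4 * s - 1 / 2 <= eps * d%:R.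
  by move: xd; rewrite /x ltr_pdivrMr // mulrDl mul1r; nra.
apply: (@approx_psd_rank_id_le _ _ r) => //.
- by rewrite (leq_trans _ r2).
- rewrite -ltnS -(ltr_nat R) -(natr1 d).
  by apply: le_lt_trans rs (le_lt_trans _ xd); rewrite /x; lra.
- by lra.
rewrite 2!natrD (natrM _ 2 (r ^ 2)) (natrM _ r d) natrX -s2.
(* It remains that (4s - 1/2) r - 2r^2 - s^2 - 2 >= 0. This is concave in s, with values r^2 - r/2 -
   2 at s = r and r^2 + 3r/2 - 3 at s = r + 1, both positive for r >= 2. *)
have : (4 * s - 1 / 2) * r%:R <= eps * d%:R * r%:R by rewrite ler_wpM2r.
nra.
Qed.
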